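(* (a) For $n\ge 2$, $\overrightarrow{trc}(\overleftrightarrow{P_n})=\overrightarrow{strc}(\overleftrightarrow{P_n})=2n-3$. (b) For $n\ge 3$, $\overrightarrow{trc}(\overleftrightarrow{C_n})=\overrightarrow{strc}(\overleftrightarrow{C_n})=g(n)$, where $g(n)=n-2$ if $n\in\{3,5\}$; $g(n)=n-1$ if $n\in\{4,6,7,8,9,10,12\}$; and $g(n)=n$ if $n=11$ or $n\ge 13$. (c) For $n\ge 4$, $\overrightarrow{trc}(\overleftrightarrow{W_n})=\overrightarrow{strc}(\overleftrightarrow{W_n})=3$. (d) Let $t\ge 2$ and let $\overleftrightarrow{K_{n_1,\dots,n_t}}$ be the biorientation of a complete $t$-partite graph with $n_i\ge 2$ for some $i$. Then $\overrightarrow{trc}(\overleftrightarrow{K_{n_1,\dots,n_t}})=\overrightarrow{strc}(\overleftrightarrow{K_{n_1,\dots,n_t}})=3$.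
   Context: The biorientation $\overleftrightarrow{G}$ of a graph $G$ replaces each edge $uv$ by the two arcs $uv$ and $vu$. $P_n$ and $C_n$ are the (undirected) path and cycle on $n$ vertices; for $n\ge 3$ the wheel $W_n$ is obtained from $C_n$ by adding a new vertex adjacent to every vertex of $C_n$; $K_{n_1,\dots,n_t}$ is the complete $t$-partite graph with class sizes $n_1,\dots,n_t$. For a strongly connected digraph $D$: a directed path is total-rainbow if its arcs and internal vertices all receive pairwise distinct colours under a total-colouring (colouring of vertices and arcs); $\overrightarrow{trc}(D)$ (resp. $\overrightarrow{strc}(D)$) is the minimum number of colours in a total-colouring such that every ordered pair $(u,v)$ of vertices is joined by a total-rainbow directed $u$–$v$ path (resp. total-rainbow shortest directed $u$–$v$ path). *)

(* Defs.v *)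
From mathcomp Require Import all_boot.
Set Implicit Arguments.
Unset Strict Implicit.
Unset Printing Implicit Defensive.

Record digraph := Digraph {
  dvertex :> finType;
  arc : rel dvertex;
  arc_irr : irreflexive arc }.

Record graph := Graph {
  gvertex :> finType;
  adj : rel gvertex;
  adj_irr : irreflexive adj;
  adj_sym : symmetric adj }.

(* An edge uv satisfies both adj u v and adj v u, hence yields the two arcs   *)
(* (u, v) and (v, u).                                                         *)
Definition biorientation (G : graph) : digraph := Digraph (@adj_irr G).

(* The directed path with vertex sequence u :: p, from u to v.                *)
Definition dipath (D : digraph) (u v : D) (p : seq D) : bool :=
  [&& path (@arc D) u p, uniq (u :: p) & last u p == v].

Definition shortest_dipath (D : digraph) (u v : D) (p : seq D) : Prop :=
  dipath u v p /\ forall q : seq D, dipath u v q -> size p <= size q.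

(* A total-colouring with colours in 'I_k. The value arc_colour u v is only   *)
(* meaningful when (u, v) is an arc; the two arcs (u, v) and (v, u) may       *)
(* receive different colours.                                                 *)
Record total_colouring (D : digraph) (k : nat) := TotalColouring {
  vertex_colour : D -> 'I_k;
  arc_colour : D -> D -> 'I_k }.

(* behead (belast u p) lists the vertices of u :: p other than its two ends.  *)
Definition total_rainbow (D : digraph) (k : nat) (c : total_colouring D k)
    (u : D) (p : seq D) : bool :=
  uniq (pairmap (arc_colour c) u p ++
        [seq vertex_colour c w | w <- behead (belast u p)]).

Definition total_rainbow_connected (D : digraph) (k : nat)
    (c : total_colouring D k) : Prop :=
  forall u v : D, exists p : seq D, dipath u v p /\ total_rainbow c u p.

Definition strongly_total_rainbow_connected (D : digraph) (k : nat)
    (c : total_colouring D k) : Prop :=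
  forall u v : D, exists p : seq D, shortest_dipath u v p /\ total_rainbow c u p.

Definition is_least (P : nat -> Prop) (k : nat) : Prop :=
  P k /\ forall m : nat, P m -> k <= m.

(* is_trc D k (resp. is_strc D k) means that the minimum defining trc(D)      *)
(* (resp. strc(D)) is attained and equals k; in particular D is then strongly *)
(* connected.                                                                 *)
Definition is_trc (D : digraph) (k : nat) : Prop :=
  is_least (fun m => exists c : total_colouring D m,
                       total_rainbow_connected c) k.

Definition is_strc (D : digraph) (k : nat) : Prop :=
  is_least (fun m => exists c : total_colouring D m,
                       strongly_total_rainbow_connected c) k.

Section PathGraph.
Variable n : nat.
Definition path_adj : rel 'I_n :=
  fun i j => (i.+1 == j :> nat) || (j.+1 == i :> nat).
Lemma path_adj_irr : irreflexive path_adj.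
Proof. by move=> i; rewrite /path_adj orbb gtn_eqF. Qed.
Lemma path_adj_sym : symmetric path_adj.
Proof. by move=> i j; rewrite /path_adj orbC. Qed.
Definition path_graph : graph := Graph path_adj_irr path_adj_sym.
End PathGraph.

Section CycleGraph.
Variable n : nat.
(* The conjunct i != j only matters for the degenerate case n = 1.            *)
Definition cycle_adj : rel 'I_n :=
  fun i j => (i != j) && ((j == ordS i) || (i == ordS j)).
Lemma cycle_adj_irr : irreflexive cycle_adj.
Proof. by move=> i; rewrite /cycle_adj eqxx. Qed.
Lemma cycle_adj_sym : symmetric cycle_adj.
Proof. by move=> i j; rewrite /cycle_adj eq_sym orbC. Qed.
Definition cycle_graph : graph := Graph cycle_adj_irr cycle_adj_sym.
End CycleGraph.

Section AddUniversalVertex.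
Variable G : graph.
(* None is the added vertex.                                                  *)
Definition cone_adj : rel (option G) := fun x y =>
  match x, y with
  | Some u, Some v => adj u v
  | None, None => false
  | _, _ => true
  end.
Lemma cone_adj_irr : irreflexive cone_adj.
Proof. by case=> [u|] //=; apply: adj_irr. Qed.
Lemma cone_adj_sym : symmetric cone_adj.
Proof. by case=> [u|] [v|] //=; apply: adj_sym. Qed.
Definition cone : graph := Graph cone_adj_irr cone_adj_sym.
End AddUniversalVertex.

Definition wheel_graph (n : nat) : graph := cone (cycle_graph n).

Section CompleteMultipartite.
Variables (t : nat) (n_ : 'I_t -> nat).
(* The vertex Tagged _ a, with tag i and a : 'I_(n_ i), is the a-th vertex of *)
(* the i-th class.                                                            *)
Definition multipartite_adj : rel {i : 'I_t & 'I_(n_ i)} :=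
  fun x y => tag x != tag y.
Lemma multipartite_adj_irr : irreflexive multipartite_adj.
Proof. by move=> x; rewrite /multipartite_adj eqxx. Qed.
Lemma multipartite_adj_sym : symmetric multipartite_adj.
Proof. by move=> x y; rewrite /multipartite_adj eq_sym. Qed.
Definition complete_multipartite : graph :=
  Graph multipartite_adj_irr multipartite_adj_sym.
End CompleteMultipartite.

(* Only used for n >= 3, where the last case is n = 11 or n >= 13.            *)
Definition g (n : nat) : nat :=
  if n \in [:: 3; 5] then n - 2
  else if n \in [:: 4; 6; 7; 8; 9; 10; 12] then n - 1
  else n.

(* Main.v *)
(* The lower bounds other than those for cycles come from counting the colours
   needed on one long path. For the cycle C_n and m < n colours, put
   l = floor((n-1)/2): a rainbow path of length d needs 2d-1 colours, so the
   clockwise path of length l from any vertex is the only possible rainbow path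
   between its ends. If a colour is used on x clockwise arcs and y vertices,
   counting its occurrences in these n paths gives l x + (l-1) y <= n. For
   n = 11 and n >= 13 this forces x + y <= 2, hence 2n <= 2m, a contradiction;
   n = 7 and n = 9 follow with other weights, and the remaining n from the
   distance between antipodal vertices. Conversely, colouring the 2n vertices
   and edges around C_n cyclically by 0, ..., n-1 makes every shortest path
   rainbow, and finitely many better colourings are given explicitly. *)

Require Import Defs.
From mathcomp Require Import all_boot.
From mathcomp Require Import zify.
Import Defs.

Set Implicit Arguments.
Unset Strict Implicit.
Unset Printing Implicit Defensive.

(** * Rainbow paths, and settling both invariants at once *)

Lemma total_rainbow_size (D : digraph) k (c : total_colouring D k) u p :
  total_rainbow c u p -> (size p).*2.-1 <= k.
Proof.
move=> /card_uniqP; rewrite size_cat size_pairmap size_map size_behead.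
rewrite size_belast => sz.
have -> : (size p).*2.-1 = size p + (size p).-1 by lia.
by rewrite -sz -[X in _ <= X]card_ord max_card.
Qed.

(** A rainbow shortest path is in particular a rainbow path, so the weak invariant is at most the
    strong one: a strong colouring and a lower bound for weak colourings pin down both. *)
Lemma is_trc_strc (D : digraph) k :
  (exists c : total_colouring D k, strongly_total_rainbow_connected c) ->
  (forall m (c : total_colouring D m), total_rainbow_connected c -> k <= m) ->
  is_trc D k /\ is_strc D k.
Proof.
have strong_weak m (c : total_colouring D m) :
    strongly_total_rainbow_connected c -> total_rainbow_connected c.
  by move=> sc u v; have [p [[dp _] rp]] := sc u v; exists p.
move=> [c sc] lb; split; split.
- by exists c; apply: strong_weak.
- by move=> m [c' /lb].
- by exists c.
- by move=> m [c' /strong_weak/lb].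
Qed.

(** * Reversing paths *)

Section Reversal.
Variable T : Type.

Lemma last_rev_belast (x : T) p : last (last x p) (rev (belast x p)) = x.
Proof. by case: p => //= y p; rewrite rev_cons last_rcons. Qed.

Lemma behead_belast_rev (x : T) p :
  behead (belast (last x p) (rev (belast x p))) = rev (behead (belast x p)).
Proof.
case/lastP: p => // p y.
by rewrite last_rcons belast_rcons rev_cons belast_rcons.
Qed.

Lemma pairmap_rev (R : Type) (f : T -> T -> R) x p :
  (forall y z, f y z = f z y) ->
  pairmap f (last x p) (rev (belast x p)) = rev (pairmap f x p).
Proof.
move=> fC; elim: p x => //= y p IH x.
by rewrite !rev_cons -!cats1 pairmap_cat IH last_rev_belast /= fC.
Qed.

End Reversal.

Lemma dipath_rev (G : graph) (u v : biorientation G) p :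
  dipath u v p -> dipath v u (rev (belast u p)).
Proof.
case/and3P=> pp up /eqP <-; apply/and3P; split.
- by rewrite rev_path -(eq_path (e := @arc _)) // => x y; apply: adj_sym.
- by move: up; rewrite lastI -rev_uniq rev_rcons.
- by rewrite last_rev_belast.
Qed.

(** When opposite arcs share a colour, the reversed path shows the same colours and has the same
    length. Symmetric colourings thus need checking for one order of each pair only. *)
Lemma strong_connection_rev (G : graph) k
    (c : total_colouring (biorientation G) k) u v :
  (forall x y, arc_colour c x y = arc_colour c y x) ->
  (exists p, shortest_dipath u v p /\ total_rainbow c u p) ->
  exists p, shortest_dipath v u p /\ total_rainbow c v p.
Proof.
move=> cC [p [[dp minp] rp]]; exists (rev (belast u p)); split; first split.
- exact: dipath_rev.
- move=> q /dipath_rev/minp.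
  by rewrite !size_rev !size_belast.
- move: rp; case/and3P: dp => _ _ /eqP <-.
  rewrite /total_rainbow pairmap_rev // behead_belast_rev map_rev.
  by rewrite -rev_cat rev_uniq uniq_catC.
Qed.

(** * Diameter two: wheels and complete multipartite graphs *)

Lemma dipath_nil (D : digraph) (u v : D) : dipath u v [::] = (u == v).
Proof. by []. Qed.

Lemma dipath_arc (D : digraph) (u v : D) : arc u v -> dipath u v [:: v].
Proof.
move=> auv; rewrite /dipath /= auv inE eqxx !andbT /=.
by apply: contraTneq auv => ->; rewrite arc_irr.
Qed.

Lemma dipath_nonarc (D : digraph) (u v : D) q :
  u != v -> ~~ arc u v -> dipath u v q -> 1 < size q.
Proof.
move=> uv nauv; case: q => [|x [|y q]] //.
  by rewrite dipath_nil (negPf uv).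
by case/and3P=> /= /andP[aux _] _ /eqP xv; rewrite -xv aux in nauv.
Qed.

Section DiameterTwo.
Variable D : digraph.

Lemma trc_nonarc_ge3 (u v : D) m (c : total_colouring D m) :
  u != v -> ~~ arc u v -> total_rainbow_connected c -> 3 <= m.
Proof.
move=> uv nauv /(_ u v)[q [dq rq]].
have := total_rainbow_size rq; have := dipath_nonarc uv nauv dq; lia.
Qed.

Lemma strong_diameter_two k (c : total_colouring D k) :
  (forall u v : D, u != v -> ~~ arc u v ->
    exists w, [/\ arc u w, arc w v
      & uniq [:: arc_colour c u w; arc_colour c w v; vertex_colour c w]]) ->
  strongly_total_rainbow_connected c.
Proof.
move=> H u v; have [<-|uv] := eqVneq u v.
  by exists [::]; split=> //; split=> //; rewrite dipath_nil.
have [auv|nauv] := boolP (arc u v).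
  exists [:: v]; split=> //; split; first exact: dipath_arc.
  by case=> //; rewrite dipath_nil (negPf uv).
have [w [auw awv cw]] := H u v uv nauv.
exists [:: w; v]; split=> //; split; last by move=> q /dipath_nonarc; apply.
apply/and3P; split; rewrite /= ?auw ?awv //.
rewrite !inE negb_or uv !andbT; apply/andP; split.
  by apply: contraTneq auw => ->; rewrite arc_irr.
by apply: contraTneq awv => ->; rewrite arc_irr.
Qed.

End DiameterTwo.

Definition col3 (i : nat) : 'I_3 := inord i.

Lemma col3_uniq i j l : i < 3 -> j < 3 -> l < 3 -> uniq [:: i; j; l] ->
  uniq [:: col3 i; col3 j; col3 l].
Proof.
move=> i3 j3 l3 /= H; rewrite !inE -!val_eqE /= !inordK //.
by move: H; rewrite !inE.
Qed.

Lemma wheel_trc n : 4 <= n ->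
  is_trc (biorientation (wheel_graph n)) 3 /\
  is_strc (biorientation (wheel_graph n)) 3.
Proof.
move=> n4; apply: is_trc_strc.
  (* Arcs into the rim get 0, arcs into the hub 1 and vertices 2, so every detour rim-hub-rim is
     rainbow. *)
  exists (@TotalColouring (biorientation (wheel_graph n)) 3
    (fun=> col3 2)
    (fun x y => if y is Some _ then col3 0 else col3 1)).
  apply: strong_diameter_two => -[u|] [v|] //= uv nauv.
  by exists None; split=> //; apply: col3_uniq.
move=> m c; have n0 : 0 < n by lia.
have n2 : 2 < n by lia.
(* The rim vertices 0 and 2 are nonadjacent because n >= 4. *)
apply: (@trc_nonarc_ge3 (biorientation (wheel_graph n))
          (Some (Ordinal n0)) (Some (Ordinal n2))) => //.
rewrite /= /cycle_adj -!val_eqE /= !modn_small; lia.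
Qed.

Lemma complete_multipartite_trc t (n_ : 'I_t -> nat) :
  2 <= t -> (forall i : 'I_t, 1 <= n_ i) -> (exists i : 'I_t, 2 <= n_ i) ->
  is_trc (biorientation (complete_multipartite n_)) 3 /\
  is_strc (biorientation (complete_multipartite n_)) 3.
Proof.
move=> t2 n1 [i n2]; apply: is_trc_strc.
  (* The colour of an arc tells whether the class index rises. Leaving a class and returning to it
     uses one arc of each colour. *)
  exists (@TotalColouring (biorientation (complete_multipartite n_)) 3
    (fun=> col3 2)
    (fun x y => if tag x < tag y then col3 0 else col3 1)).
  apply: strong_diameter_two => u v uv /=.
  rewrite /multipartite_adj negbK => /eqP tuv.
  have [j ju] : exists j : 'I_t, j != tag u.
    have t0 : 0 < t by lia.
    have [e|H] := eqVneq (Ordinal t0) (tag u); last by exists (Ordinal t0).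
    by exists (Ordinal t2); rewrite -e.
  exists (Tagged (fun i => 'I_(n_ i)) (Ordinal (n1 j))).
  rewrite /= -tuv ju eq_sym ju; split=> //.
  move: ju; rewrite -val_eqE /=; case: ltngtP => // _ _; exact: col3_uniq.
move=> m c.
pose w (a : 'I_(n_ i)) : biorientation (complete_multipartite n_) :=
  Tagged (fun i => 'I_(n_ i)) a.
apply: (@trc_nonarc_ge3 _ (w (Ordinal (n1 i))) (w (Ordinal n2))).
  by rewrite eq_Tagged.
by rewrite /= /multipartite_adj eqxx.
Qed.

(** * Colours along the orbit of a map *)

Lemma traject_map (T : Type) (f : T -> T) x m :
  traject f x m = [seq iter j f x | j <- iota 0 m].
Proof.
elim: m x => //= m IH x; rewrite IH (iotaDl 1 0) -map_comp.
by congr cons; apply: eq_map => j /=; rewrite -iterSr.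
Qed.

Lemma pairmap_traject (T R : Type) (h : T -> T -> R) (f : T -> T) x m :
  pairmap h x (traject f (f x) m) =
  [seq h (iter j f x) (iter j.+1 f x) | j <- iota 0 m].
Proof.
elim: m x => //= m IH x; rewrite IH (iotaDl 1 0) -map_comp.
by congr cons; apply: eq_map => j /=; rewrite -!iterSr.
Qed.

Lemma behead_belast_traject (T : Type) (f : T -> T) x m :
  behead (belast x (traject f (f x) m)) =
  [seq iter j.+1 f x | j <- iota 0 m.-1].
Proof.
have -> : belast x (traject f (f x) m) = traject f x m.
  by elim: m x => //= m IH x; rewrite IH.
case: m => //= m; rewrite traject_map; apply: eq_map => j.
by rewrite -iterSr.
Qed.

Lemma total_rainbow_traject (D : digraph) k (c : total_colouring D k)
    (f : D -> D) u l :
  total_rainbow c u (traject f (f u) l) =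
  uniq ([seq arc_colour c (iter j f u) (iter j.+1 f u) | j <- iota 0 l] ++
        [seq vertex_colour c (iter j.+1 f u) | j <- iota 0 l.-1]).
Proof.
by rewrite /total_rainbow pairmap_traject behead_belast_traject -map_comp.
Qed.

Lemma val_iter_ordS n j (u : 'I_n) : iter j (@ordS n) u = (u + j) %% n :> nat.
Proof.
elim: j => [|j IH] /=; first by rewrite addn0 modn_small.
by rewrite IH -addn1 modnDml addn1 addnS.
Qed.

Lemma uniq_traject_ordS n (u : 'I_n) l : l < n ->
  uniq (u :: traject (@ordS n) (ordS u) l).
Proof.
move=> ln; rewrite -trajectS traject_map map_inj_in_uniq ?iota_uniq //.
move=> i j; rewrite !mem_iota => /andP[_ il] /andP[_ jl] /(congr1 val).
rewrite /= !val_iter_ordS => /eqP; rewrite eqn_modDl !modn_small; lia.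
Qed.

(* Injectivity on the positions of an alternating walk: the arcs sit at the
   odd positions, the internal vertices at the even ones. *)
Lemma uniq_alternating (T : eqType) (F : nat -> T) l :
  {in [pred q | 0 < q < l.*2] &, injective F} ->
  uniq ([seq F j.*2.+1 | j <- iota 0 l] ++ [seq F j.*2.+2 | j <- iota 0 l.-1]).
Proof.
move=> Finj.
rewrite (map_comp F (fun j => j.*2.+1)) (map_comp F (fun j => j.*2.+2)) -map_cat.
rewrite map_inj_in_uniq.
  rewrite cat_uniq !map_inj_uniq ?iota_uniq ?andbT /=; try by move=> i j; lia.
  apply/hasPn => _ /mapP[j _ ->]; apply/negP => /mapP[i _]; lia.
have lt q : q \in [seq j.*2.+1 | j <- iota 0 l] ++ [seq j.*2.+2 | j <- iota 0 l.-1] ->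
    0 < q < l.*2.
  by rewrite mem_cat => /orP[] /mapP[j]; rewrite mem_iota => H ->; lia.
by move=> p q /lt lp /lt lq; apply: Finj; rewrite inE.
Qed.

(** * Paths *)

Section Path.
Variable n : nat.
Let D := biorientation (path_graph n).

(** Each arc changes the index by one. This gives both the minimality of monotone paths and the
    lower bound. *)
Lemma path_last_le (u : D) p : path (@arc D) u p ->
  (last u p <= u + size p) && (u <= last u p + size p).
Proof.
elim: p u => [|x p IH] u /=; first by rewrite addn0 leqnn.
move=> /andP[ux /IH]; move: ux; rewrite /path_adj.
set w := last _ _.
move: (nat_of_ord u) (nat_of_ord x) (nat_of_ord w) (size p) => a b e m.
lia.
Qed.

Lemma path_dipath_ordS (u v : D) : u <= v ->
  dipath u v (traject (@ordS n) (ordS u) (v - u)).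
Proof.
move=> uv; have vn := ltn_ord v; apply/and3P; split.
- have pS m (x : D) : x + m < n -> path (@arc D) x (traject (@ordS n) (ordS x) m).
    elim: m x => //= m IH x xm; apply/andP; split.
      by rewrite /path_adj /= modn_small ?eqxx //; lia.
    by apply: IH; rewrite /= modn_small; lia.
  by apply: pS; lia.
- by apply: uniq_traject_ordS; lia.
- rewrite last_traject; apply/eqP/val_inj.
  by rewrite /= val_iter_ordS subnKC // modn_small.
Qed.

Lemma path_trc : 2 <= n -> is_trc D (2 * n - 3) /\ is_strc D (2 * n - 3).
Proof.
move=> n2; apply: is_trc_strc; last first.
  (* The two end vertices are at distance n-1, which costs 2(n-1)-1 colours. *)
  move=> m c; have n0 : 0 < n by lia.
  have n1 : n.-1 < n by lia.
  move=> /(_ (Ordinal n0) (Ordinal n1))[p [/and3P[pp _ /eqP lp] rp]].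
  have := total_rainbow_size rp; have := path_last_le pp.
  rewrite lp /=; lia.
case nk: (2 * n - 3) => [|k]; first lia.
(* With vertex i at position 2i and the edge from i to i+1 at 2i+1, the colour is the position minus
   one. Edges and inner vertices fill 0, ..., 2n-4; the end vertices, never internal to a path, fall
   back on a truncated and a default value. *)
pose c := @TotalColouring D k.+1 (fun u => inord (u.*2.-1))
  (fun u v => inord ((u + v).-1)).
have cC x y : arc_colour c x y = arc_colour c y x by rewrite /= addnC.
exists c => u v; wlog uv : u v / u <= v.
  move=> H; have [|/ltnW vu] := leqP u v; first exact: H.
  by apply: strong_connection_rev => //; apply: H.
exists (traject (@ordS n) (ordS u) (v - u)); split; first split.
- exact: path_dipath_ordS.
- move=> q /and3P[/path_last_le lq _ /eqP vq].
  move: lq; rewrite vq size_traject; lia.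
rewrite (total_rainbow_traject c (@ordS n)) /=.
have vn := ltn_ord v.
have val_iter j : j <= v - u -> iter j (@ordS n) u = u + j :> nat.
  by move=> ju; rewrite val_iter_ordS modn_small; lia.
(* [F q] is the colour met q half-steps after [u]: odd q for arcs, even q for internal vertices. *)
pose F q : 'I_k.+1 := inord ((u.*2 + q).-1).
have -> : [seq inord (iter j (@ordS n) u + ordS (iter j (@ordS n) u)).-1
            | j <- iota 0 (v - u)] = [seq F j.*2.+1 | j <- iota 0 (v - u)].
  apply/eq_in_map => j; rewrite mem_iota => ju.
  rewrite -iterS !val_iter; try lia.
  by congr inord; lia.
have -> : [seq inord (ordS (iter j (@ordS n) u)).*2.-1
            | j <- iota 0 (v - u).-1] = [seq F j.*2.+2 | j <- iota 0 (v - u).-1].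
  apply/eq_in_map => j; rewrite mem_iota => ju.
  rewrite -iterS !val_iter; try lia.
  by congr inord; lia.
apply: uniq_alternating => p q; rewrite !inE => pl ql /(congr1 val) /=.
rewrite !inordK; lia.
Qed.

End Path.

(** * Cycles: shape of directed paths and criteria for colourings *)

Lemma eqn_addl_mod n a i j : i < n -> j < n ->
  (a + i) %% n = (a + j) %% n -> i = j.
Proof. by move=> iN jN /eqP; rewrite eqn_modDl !modn_small // => /eqP. Qed.

Section Cycle.
Variable n : nat.
Hypothesis n3 : 2 < n.
Let D := biorientation (cycle_graph n).

Lemma ordS_neq (u : 'I_n) : ordS u != u.
Proof.
rewrite -val_eqE /=; have := ltn_ord u.
by case: (ltngtP u.+1 n) => // [lt|e] _; rewrite ?e ?modnn ?modn_small //; lia.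
Qed.

Lemma ordS_ordS_neq (u : 'I_n) : ordS (ordS u) != u.
Proof.
apply/eqP => /(congr1 val) /=; rewrite -addn1 modnDml => e.
suff: 2 = 0 by [].
apply: (@eqn_addl_mod n u) => //; first lia.
by rewrite addn0 (modn_small (ltn_ord u)) -[RHS]e; congr (_ %% _); lia.
Qed.

Lemma cycle_arcE (u v : D) : arc u v = (v == ordS u) || (v == @ord_pred n u).
Proof.
rewrite /= /cycle_adj.
have -> : (u == ordS v) = (v == @ord_pred n u).
  by apply/eqP/eqP => ->; rewrite ?ordSK ?ord_predK.
case: (eqVneq v (ordS u)) => [->|_]; first by rewrite eq_sym ordS_neq.
case: (eqVneq v (@ord_pred n u)) => [->|_] /=; last by rewrite andbF.
by rewrite -{1}[u](@ord_predK n) ordS_neq.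
Qed.

(** Turning round would revisit the vertex just left, so a path keeps the direction of its first
    step. *)
Lemma cycle_path_traject (u : D) p : path (@arc D) u p -> uniq (u :: p) ->
  p = traject (@ordS n) (ordS u) (size p) \/
  p = traject (@ord_pred n) (ord_pred u) (size p).
Proof.
elim: p u => [|x p IH] u; first by left.
rewrite cons_uniq => /andP[ux pp] /andP[uNp up].
have uNp' : u \notin p by apply: contra uNp; rewrite inE orbC => ->.
move: ux (IH x pp up); rewrite cycle_arcE.
case: p uNp' {pp up uNp IH} => [|y p]; first by move=> _ /orP[]/eqP -> _; [left|right].
rewrite inE negb_or => /andP[uy _] /orP[]/eqP xE [] e.
- by left; rewrite {1}e xE.
- by case: e => yE; rewrite yE xE ordSK eqxx in uy.
- by case: e => yE; rewrite yE xE ord_predK eqxx in uy.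
- by right; rewrite {1}e xE.
Qed.

Lemma iter_ord_predK m (u : 'I_n) : iter m (@ordS n) (iter m (@ord_pred n) u) = u.
Proof. by elim: m => // m IH; rewrite iterSr /= ord_predK. Qed.

Lemma cycle_dipath_size (u v : D) p : dipath u v p ->
  size p < n /\ ((u + size p) %% n = v \/ (v + size p) %% n = u).
Proof.
case/and3P=> pp up /eqP lp; split.
  by have := max_card (mem (u :: p)); rewrite (card_uniqP up) /= card_ord.
case: (cycle_path_traject pp up) => pE; [left | right].
  by rewrite -lp {2}pE last_traject /= val_iter_ordS.
by rewrite -lp {1}pE last_traject /= -val_iter_ordS iter_ord_predK.
Qed.

Lemma cycle_dipath_ordS (u v : D) l : l < n -> (u + l) %% n = v ->
  dipath u v (traject (@ordS n) (ordS u) l).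
Proof.
move=> ln uv; apply/and3P; split; first 1 last.
- exact: uniq_traject_ordS.
- by rewrite last_traject; apply/eqP/val_inj; rewrite /= val_iter_ordS.
elim: l (u) {ln uv} => //= l IH x; apply/andP; split; last exact: IH.
have := cycle_arcE x (ordS x); rewrite eqxx /= => ->.
by [].
Qed.

Lemma cycle_shortest_ordS (u v : D) l : l.*2 <= n -> (u + l) %% n = v ->
  shortest_dipath u v (traject (@ordS n) (ordS u) l).
Proof.
move=> ln uv; have l_n : l < n by lia.
split=> [|q /cycle_dipath_size[qn]]; first exact: cycle_dipath_ordS.
rewrite size_traject -uv => -[/eqn_addl_mod -> //|].
rewrite modnDml -addnA -[X in _ = X](modn_small (ltn_ord u)) -{2}[nat_of_ord u]addn0.
(* Here [q] runs the other way, so n divides [l + size q]: either the sum is 0, or it is at least n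
   and [size q] is at least n - l >= l. *)
have [lq|] := ltnP (l + size q) n; last by lia.
by move/eqn_addl_mod => /(_ lq); lia.
Qed.

Lemma cycle_near (u v : D) :
  exists l, l.*2 <= n /\ ((u + l) %% n = v \/ (v + l) %% n = u).
Proof.
wlog uv : u v / u <= v.
  move=> H; have [/H //|/ltnW/H[l [ln]]] := leqP u v.
  by move=> uv; exists l; split=> //; case: uv; [right|left].
have [un vn] := (ltn_ord u, ltn_ord v).
have [d|d] := leqP (v - u).*2 n.
  by exists (v - u); split=> //; left; rewrite subnKC // modn_small.
exists (n - (v - u)); split; first lia.
right; have -> : v + (n - (v - u)) = u + n by lia.
by rewrite modnDr modn_small.
Qed.

(** The colours met on the clockwise walk of length [l] from [u], edges first, as in
    [total_rainbow]. *)
Definition cycle_window (T : Type) (f : nat -> T) u l :=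
  [seq f ((u + j) %% n).*2.+1 | j <- iota 0 l] ++
  [seq f ((u + j.+1) %% n).*2 | j <- iota 0 l.-1].

(* Around the cycle, vertex i has position 2i and the edge between i and i+1
   has position 2i+1; f gives the colour of each position. *)
Lemma cycle_strong_colouring k (f : nat -> nat) : 0 < k ->
  (forall q, f q < k) ->
  (forall u l, u < n -> l.*2 < n -> uniq (cycle_window f u l)) ->
  (forall u, u < n -> ~~ odd n ->
    uniq (cycle_window f u n./2) || uniq (cycle_window f ((u + n./2) %% n) n./2)) ->
  exists c : total_colouring D k, strongly_total_rainbow_connected c.
Proof.
case: k => // k _ fk fu fh.
pose c := @TotalColouring D k.+1 (fun u => inord (f u.*2))
  (fun u v => if v == ordS u then inord (f u.*2.+1)
              else if u == ordS v then inord (f v.*2.+1) else ord0).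
have cC x y : arc_colour c x y = arc_colour c y x.
  rewrite /=; case: (eqVneq y (ordS x)) => [->|_] //.
  by rewrite eq_sym (negPf (ordS_ordS_neq x)).
have rainbow (u : D) l : uniq (cycle_window f u l) ->
    total_rainbow c u (traject (@ordS n) (ordS u) l).
  rewrite (total_rainbow_traject c (@ordS n)) /=.
  rewrite -(map_inj_in_uniq (f := @inord k)); last first.
    move=> x y xw yw /(congr1 val) /=.
    have lt z : z \in cycle_window f u l -> z < k.+1.
      by rewrite mem_cat => /orP[]/mapP[j _ ->].
    by rewrite !inordK ?lt.
  rewrite map_cat -!map_comp; congr (uniq (_ ++ _)); apply: eq_map => j /=.
    by rewrite eqxx -val_iter_ordS.
  by rewrite -val_iter_ordS.
exists c => u v.
have [l [ln]] := cycle_near u v.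
wlog uv : u v / (u + l) %% n = v.
  move=> H [uv|vu]; first by apply: H => //; left.
  by apply: strong_connection_rev => //; apply: H => //; left.
move=> _.
have := ln; rewrite leq_eqVlt => /orP[/eqP ln2|ltln]; last first.
  exists (traject (@ordS n) (ordS u) l).
  by split; [apply: cycle_shortest_ordS | apply: rainbow; apply: fu => //].
(* For antipodal vertices both half-turns are shortest. If only the one starting at [v] is rainbow,
   its reversal joins [u] to [v]. *)
have nE : ~~ odd n by rewrite -ln2 odd_double.
have lE : n./2 = l by rewrite -ln2 doubleK.
have := fh u (ltn_ord u) nE; rewrite lE uv => /orP[] W.
  exists (traject (@ordS n) (ordS u) l).
  by split; [apply: cycle_shortest_ordS | apply: rainbow].
apply: strong_connection_rev => //; exists (traject (@ordS n) (ordS v) l).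
split; last exact: rainbow.
apply: cycle_shortest_ordS => //.
by rewrite -uv modnDml -addnA addnn ln2 modnDr modn_small.
Qed.

Lemma cycle_antipode_bound m (c : total_colouring D m) :
  total_rainbow_connected c -> (n./2).*2.-1 <= m.
Proof.
move=> tc; have n0 : 0 < n by lia.
have nh : n./2 < n by lia.
have [p [dp /total_rainbow_size rp]] := tc (Ordinal n0) (Ordinal nh).
have [pn] := cycle_dipath_size dp.
have nn : n./2 + (n - n./2) = n by lia.
rewrite /= add0n (modn_small pn) => -[pE|]; first by lia.
have [lt|] := ltnP (n./2 + size p) n; last by lia.
by rewrite modn_small //; lia.
Qed.

(** The other way round has length n - l and would need 2(n-l)-1 >= n > m colours. *)
Lemma cycle_forced_rainbow m (c : total_colouring D m) (u : D) l :
  m < n -> l.*2 < n -> total_rainbow_connected c ->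
  total_rainbow c u (traject (@ordS n) (ordS u) l).
Proof.
move=> mn ln tc; have [->//|l0] := posnP l.
have [p [dp rp]] := tc u (iter l (@ordS n) u).
have [pn pv] := cycle_dipath_size dp; have psz := total_rainbow_size rp.
case/and3P: dp => pp up /eqP lp.
have pl : size p = l.
  move: pv; rewrite val_iter_ordS => -[/eqn_addl_mod -> //|]; first lia.
  rewrite modnDml -addnA -[X in _ = X](modn_small (ltn_ord u)).
  rewrite -{2}[nat_of_ord u]addn0 => /eqn_addl_mod H.
  have lpn : l + size p < n by lia.
  by have := H lpn; lia.
case: (cycle_path_traject pp up) => pE; first by rewrite -pl -pE.
(* Equal lengths in opposite directions with the same end would make n divide 2l, although 0 < 2l <
   n. *)
move: lp; rewrite pE last_traject pl => e.
have : (u + l.*2) %% n = (u + 0) %% n.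
  rewrite addn0 (modn_small (ltn_ord u)).
  rewrite -addnn addnA -modnDml -val_iter_ordS -e -val_iter_ordS.
  by rewrite iter_ord_predK.
by move/eqn_addl_mod => H; have := H ln; lia.
Qed.

End Cycle.

(** * Counting colour occurrences: the lower bound for cycles *)

Lemma count_mem_iota (C : eqType) (F : nat -> C) c m :
  count_mem c [seq F j | j <- iota 0 m] = \sum_(j < m) (F j == c).
Proof.
elim: m => [|m IH]; first by rewrite big_ord0.
by rewrite -addn1 iotaD map_cat count_cat IH addn1 big_ord_recr /= addn0.
Qed.

Section WindowCount.
Variables (T C : finType) (s : T -> T) (l : nat) (A V : T -> C).
Hypothesis s_inj : injective s.
Hypothesis windows : forall u,
  uniq ([seq A (iter j s u) | j <- iota 0 l] ++
        [seq V (iter j.+1 s u) | j <- iota 0 l.-1]).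

(* A colour occurs at most once in each of the #|T| windows, while each arc
   lies in l windows and each vertex in l - 1. *)
Lemma window_count c :
  l * (\sum_u (A u == c)) + l.-1 * (\sum_u (V u == c)) <= #|T|.
Proof.
have shift (B : T -> C) j :
    \sum_u (B (iter j s u) == c) = \sum_u (B u == c) :> nat.
  rewrite [RHS](reindex_inj (h := iter j s)) //.
  by elim: j => //= j IH x y /s_inj/IH.
have wc (B : T -> C) i m :
    \sum_u count_mem c [seq B (iter (j + i) s u) | j <- iota 0 m] =
    m * \sum_u (B u == c).
  rewrite (eq_bigr _ (fun u _ => count_mem_iota _ c m)).
  rewrite exchange_big /= (eq_bigr (fun=> \sum_u (B u == c))).
    by rewrite sum_nat_const card_ord.
  by move=> j _; rewrite shift.
have -> : l * \sum_u (A u == c) + l.-1 * \sum_u (V u == c) =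
  \sum_u count_mem c ([seq A (iter j s u) | j <- iota 0 l] ++
                      [seq V (iter j.+1 s u) | j <- iota 0 l.-1]).
  rewrite -(wc A 0) -(wc V 1) -big_split /=; apply: eq_bigr => u _.
  rewrite count_cat; congr (_ + _); congr (count_mem _ _); apply: eq_map => j.
    by rewrite addn0.
  by rewrite addn1.
rewrite -sum1_card; apply: leq_sum => u _.
by rewrite count_uniq_mem // leq_b1.
Qed.

End WindowCount.

(** Sum over all colours: each of the families [A] and [V] has [#|T|] members, each with exactly one
    colour. *)
Lemma weighted_colour_count (T C : finType) (A V : T -> C) a b M :
  (forall c, a * (\sum_u (A u == c)) + b * (\sum_u (V u == c)) <= M) ->
  (a + b) * #|T| <= M * #|C|.
Proof.
have tot (B : T -> C) : \sum_c \sum_u (B u == c) = #|T|.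
  rewrite exchange_big -sum1_card; apply: eq_bigr => u _.
  by rewrite (bigD1 (B u)) //= eqxx big1 ?addn0 // => c; rewrite eq_sym => /negPf ->.
move=> H; rewrite mulnDl -{1}(tot A) -(tot V) !big_distrr -big_split /=.
by rewrite mulnC -sum_nat_const; apply: leq_sum.
Qed.

(** Any linear consequence of the window inequality for a single colour may be summed over the m
    colours. *)
Lemma cycle_weighted_bound n m a b M
    (c : total_colouring (biorientation (cycle_graph n)) m) :
  2 < n -> m < n -> total_rainbow_connected c ->
  (forall x y, (n.-1)./2 * x + (n.-1)./2.-1 * y <= n -> a * x + b * y <= M) ->
  (a + b) * n <= M * m.
Proof.
move=> n3 mn tc abM.
rewrite -[X in _ <= _ * X](card_ord m) -[X in _ * X <= _](card_ord n).
apply: (@weighted_colour_count _ _ (fun u => arc_colour c u (ordS u))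
          (vertex_colour c)) => k.
apply: abM; rewrite -[X in _ <= X](card_ord n).
apply: (window_count (s := @ordS n)) => [|u]; first exact: ordS_inj.
have l2 : (n.-1)./2.*2 < n by lia.
by have := cycle_forced_rainbow n3 u mn l2 tc; rewrite (total_rainbow_traject c (@ordS n)).
Qed.

Lemma cycle_lower n m (c : total_colouring (biorientation (cycle_graph n)) m) :
  2 < n -> total_rainbow_connected c -> g n <= m.
Proof.
move=> n3 tc; rewrite leqNgt; apply/negP => mg.
have half := cycle_antipode_bound n3 tc.
have gn : g n <= n by rewrite /g; case: ifP => _; [|case: ifP => _]; lia.
have mn : m < n by lia.
have wb a b M := @cycle_weighted_bound n m a b M c n3 mn tc.
have [n12|n13] := leqP n 12; last first.
  suff: (1 + 1) * n <= 2 * m by lia.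
  (* With l = floor((n-1)/2), each occurrence weighs at least l-1, and 3(l-1) > n once n > 12; so a
     colour occurs at most twice. *)
  apply: wb => x y; nia.
(* For n = 7 and 9 the weights (2, 1) and (3, 2) are chosen so that their
   maxima 4 and 6 over the feasible (x, y) times m stay below 3 n and 5 n. *)
have n7 : n != 7.
  apply/eqP => nE; have gE : g n = 6 by rewrite nE.
  suff: (2 + 1) * n <= 4 * m by lia.
  by apply: wb => x y; rewrite nE /=; lia.
have n9 : n != 9.
  apply/eqP => nE; have gE : g n = 8 by rewrite nE.
  suff: (3 + 2) * n <= 6 * m by lia.
  by apply: wb => x y; rewrite nE /=; lia.
have n11 : n != 11.
  apply/eqP => nE; have gE : g n = 11 by rewrite nE.
  suff: (1 + 1) * n <= 2 * m by lia.
  by apply: wb => x y; rewrite nE /=; lia.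
(* For the remaining n, namely 3, 4, 5, 6, 8, 10 and 12, the antipodal bound equals [g n]. *)
suff : g n <= (n./2).*2.-1 by lia.
have : n \in iota 3 10 by rewrite mem_iota; lia.
rewrite !inE (negPf n7) (negPf n9) (negPf n11).
by do !case/predU1P => [->|] //; move/eqP=> ->.
Qed.

(** * Colourings of cycles attaining the bound *)

(** A window occupies 2l-1 < n consecutive positions, whose residues modulo n differ. Wrapping round
    shifts positions by 2n, which is invisible modulo n. *)
Lemma cycle_window_mod n u l : l.*2 <= n ->
  uniq (cycle_window n (fun q => q %% n) u l).
Proof.
move=> ln; rewrite /cycle_window.
pose F q := (u.*2 + q) %% n.
have fold_mod i r : (((u + i) %% n).*2 + r) %% n = (u.*2 + (i.*2 + r)) %% n.
  by rewrite -muln2 -modnDml modnMml modnDml; congr (_ %% _); lia.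
rewrite (eq_map (g := fun j => F j.*2.+1)); last first.
  by move=> j; rewrite /= -addn1 fold_mod addn1.
rewrite (eq_map (f := fun j => ((u + j.+1) %% n).*2 %% n)
                (g := fun j => F j.*2.+2)); last first.
  by move=> j; rewrite /= -[_.*2]addn0 fold_mod addn0.
apply: uniq_alternating => p q; rewrite !inE => pl ql /eqn_addl_mod; apply; lia.
Qed.

(* Found by computer search, listing the colours of positions 0, ..., 2n-1 for
   n = 3, ..., 12; the case n = 11 is a dummy. *)
Definition cycle_positions n : seq nat :=
  nth [::] [::
    [:: 0; 0; 0; 0; 0; 0];
    [:: 0; 1; 2; 0; 1; 2; 0; 0];
    [:: 1; 0; 2; 1; 2; 0; 2; 1; 0; 2];
    [:: 2; 1; 4; 2; 3; 0; 1; 4; 3; 2; 1; 0];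
    [:: 5; 0; 3; 1; 4; 2; 3; 0; 4; 1; 5; 2; 3; 4];
    [:: 4; 1; 5; 2; 6; 3; 4; 0; 1; 5; 6; 2; 4; 3; 5; 0];
    [:: 6; 0; 4; 1; 5; 2; 6; 3; 4; 0; 5; 1; 6; 2; 4; 3; 5; 7];
    [:: 8; 1; 6; 2; 7; 3; 8; 4; 5; 0; 1; 6; 7; 2; 8; 3; 5; 4; 7; 0];
    [::];
    [:: 10; 3; 4; 0; 5; 6; 9; 2; 10; 7; 8; 1; 3; 4; 9; 0; 10; 5; 6; 2; 7; 8;
        9; 1]] (n - 3).

(** The hypotheses of [cycle_strong_colouring] in a form decided by evaluation; [l < uphalf n]
    amounts to [l.*2 < n]. *)
Definition cycle_positions_ok n :=
  let f := nth 0 (cycle_positions n) in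
  all (fun q => q < g n) (cycle_positions n) &&
  all (fun u =>
    all (fun l => uniq (cycle_window n f u l)) (iota 0 (uphalf n)) &&
    (odd n || uniq (cycle_window n f u n./2)
           || uniq (cycle_window n f ((u + n./2) %% n) n./2))) (iota 0 n).

Lemma cycle_positions_okP n : n \in [:: 3; 4; 5; 6; 7; 8; 9; 10; 12] ->
  cycle_positions_ok n.
Proof. by rewrite !inE; do !case/predU1P=> [->|]; [vm_compute..|move/eqP->; vm_compute]. Qed.

Lemma cycle_upper n : 2 < n ->
  exists c : total_colouring (biorientation (cycle_graph n)) (g n),
    strongly_total_rainbow_connected c.
Proof.
move=> n3; have g0 : 0 < g n.
  by rewrite /g; case: ifP => _; [|case: ifP => _]; lia.
have [small|large] := boolP (n \in [:: 3; 4; 5; 6; 7; 8; 9; 10; 12]).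
  have /andP[lt /allP ok] := cycle_positions_okP small.
  apply: (cycle_strong_colouring n3 (f := nth 0 (cycle_positions n))) => //.
  - move=> q; have [qs|qs] := ltnP q (size (cycle_positions n)).
      exact: (all_nthP 0 lt).
    (* Positions beyond the list take the default colour 0, which is below [g n]. *)
    by rewrite nth_default.
  - move=> u l un ln; have := ok u; rewrite mem_iota => /(_ un)/andP[/allP okl _].
    by apply: okl; rewrite mem_iota; lia.
  - move=> u un nE; have := ok u; rewrite mem_iota => /(_ un)/andP[_].
    by rewrite (negPf nE).
have gE : g n = n.
  move: large; rewrite /g !inE.
  by case: ifP => [|_]; [lia|case: ifP => [|//]; lia].
rewrite gE; apply: (cycle_strong_colouring n3 (f := fun q => q %% n)).
- lia.
- by move=> q; rewrite ltn_pmod //; lia.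
- by move=> u l _ ln; apply: cycle_window_mod; lia.
- by move=> u _ _; rewrite cycle_window_mod //; lia.
Qed.

Theorem theorem9 :
  (forall n : nat, 2 <= n ->
     is_trc (biorientation (path_graph n)) (2 * n - 3) /\
     is_strc (biorientation (path_graph n)) (2 * n - 3)) /\
  (forall n : nat, 3 <= n ->
     is_trc (biorientation (cycle_graph n)) (g n) /\
     is_strc (biorientation (cycle_graph n)) (g n)) /\
  (forall n : nat, 4 <= n ->
     is_trc (biorientation (wheel_graph n)) 3 /\
     is_strc (biorientation (wheel_graph n)) 3) /\
  (forall (t : nat) (n_ : 'I_t -> nat), 2 <= t ->
     (forall i : 'I_t, 1 <= n_ i) -> (exists i : 'I_t, 2 <= n_ i) ->
     is_trc (biorientation (complete_multipartite n_)) 3 /\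
     is_strc (biorientation (complete_multipartite n_)) 3).
Proof.
split; first exact: path_trc.
split=> [n n3|].
  by apply: is_trc_strc => [|m c]; [exact: cycle_upper | exact: cycle_lower].
split; [exact: wheel_trc | exact: complete_multipartite_trc].
Qed.
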